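(* Let $D$ be any sample depth function, let $\mathbf{X}=\{\mathbf{x}_1,\dots,\mathbf{x}_n\}\subset\mathbb{R}^d$ be a data set and $\mathbf{x}\in\mathbb{R}^d$ a fixed point. Let $\beta_i=i/n$ for $i=1,\dots,b$ (with $2\le b\le n$), let $LD(\beta_i)$ be the sample $\beta_i$-local depth of $\mathbf{x}$ with respect to $\mathbf{X}$, and let $ILD(\beta_i)$ be the uniformly weighted sample $\beta$-integrated local depth of $\mathbf{x}$ up to locality level $\beta_i$. Define $$\Delta=\max_{1<i\le b}|LD(\beta_i)-LD(\beta_{i-1})|,\qquad \Delta^\dagger=\max_{1\le i<j\le b}|LD(\beta_i)-LD(\beta_j)| .$$ Then $$\max_{1<i\le b}|ILD(\beta_i)-ILD(\beta_{i-1})|\le\tfrac12\Delta ,$$ and, for every $1<i\le b$, $$|ILD(\beta_i)-ILD(\beta_{i-1})|\le\frac{\Delta^\dagger}{i}.$$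
   Context: A sample depth function assigns to each point $\mathbf{z}\in\mathbb{R}^d$ and finite data set $\mathbf{Y}$ a value $D(\mathbf{z}\mid\mathbf{Y})\in[0,1]$; any minimum sample size requirement for computing $D$ is ignored. Sample $\beta$-local depth: for $\beta\in(0,1]$, let $\mathbf{X}_{R\mathbf{x}}=\mathbf{X}\cup\{2\mathbf{x}-\mathbf{x}_j: j=1,\dots,n\}$; the $\beta$-neighborhood of $\mathbf{x}$ is the set of the $\lceil n\beta\rceil$ points $\mathbf{x}_i\in\mathbf{X}$ with the largest values of $D(\mathbf{x}_i\mid\mathbf{X}_{R\mathbf{x}})$ (ties broken by a fixed rule); $LD(\beta)$ is the depth $D$ of $\mathbf{x}$ with respect to the $\beta$-neighborhood. As a function of $\beta$ it is a step function, constant on each $((i-1)/n,i/n]$. Uniformly weighted sample $\beta$-integrated local depth: $ILD(\beta_i)=\int_0^{1}LD(\beta)\,w(\beta)\,d\beta$, where $w$ is the uniform density on $(0,\beta_i]$, i.e. $w(\beta)=1/\beta_i$ for $0<\beta\le\beta_i$ and $0$ otherwise. Equivalently, $ILD(\beta_i)=\frac1i\sum_{j=1}^iLD(\beta_j)$. *)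

(* Defs.v *)
From HB Require Import structures.
From mathcomp Require Import all_boot all_order all_algebra.
From mathcomp Require Import finmap multiset.
From mathcomp Require Import all_classical all_reals all_analysis.

Set Implicit Arguments.
Unset Strict Implicit.
Unset Printing Implicit Defensive.

Import Order.TTheory GRing.Theory Num.Theory.
Import numFieldNormedType.Exports.

Local Open Scope classical_set_scope.
Local Open Scope ring_scope.

(* Data sets are finite multisets: observations may coincide, and a depth
   does not depend on the order in which they are listed. The value on the
   empty data set is an arbitrary element of [0, 1]. *)
Definition is_sample_depth (R : realType) (d : nat)
    (D : 'rV[R]_d -> {mset 'rV[R]_d}%mset -> R) : Prop :=
  forall z Y, 0 <= D z Y <= 1.

Definition dataset (R : realType) (d n : nat) (X : 'I_n -> 'rV[R]_d)
    (N : {set 'I_n}) : {mset 'rV[R]_d}%mset :=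
  seq_mset [seq X i | i <- enum N].

(* The union is a sum of multisets, i.e. a sample of size 2n even when an
   observation coincides with a reflected one. *)
Definition reflected_dataset (R : realType) (d n : nat)
    (X : 'I_n -> 'rV[R]_d) (x : 'rV[R]_d) : {mset 'rV[R]_d}%mset :=
  msetD (dataset X [set: 'I_n]%SET)
        (dataset (fun j => 2 *: x - X j) [set: 'I_n]%SET).

(* A fixed way of resolving ties: from the labelled data X and the scores s of
   its points, [T X s k] selects k indices of largest score. The choice among
   equal scores is unconstrained, and may depend on X and on k. *)
Definition is_top_rule (R : realType) (d n : nat)
    (T : ('I_n -> 'rV[R]_d) -> ('I_n -> R) -> nat -> {set 'I_n}) : Prop :=
  forall X s k, (k <= n)%N ->
    #|T X s k| = k /\
    (forall i j, i \in T X s k -> j \notin T X s k -> s j <= s i).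

Definition beta_neighborhood (R : realType) (d n : nat)
    (D : 'rV[R]_d -> {mset 'rV[R]_d}%mset -> R)
    (T : ('I_n -> 'rV[R]_d) -> ('I_n -> R) -> nat -> {set 'I_n})
    (X : 'I_n -> 'rV[R]_d) (x : 'rV[R]_d) (beta : R) : {set 'I_n} :=
  T X (fun i => D (X i) (reflected_dataset X x)) `|Num.ceil (n%:R * beta)|%N.

Definition local_depth (R : realType) (d n : nat)
    (D : 'rV[R]_d -> {mset 'rV[R]_d}%mset -> R)
    (T : ('I_n -> 'rV[R]_d) -> ('I_n -> R) -> nat -> {set 'I_n})
    (X : 'I_n -> 'rV[R]_d) (x : 'rV[R]_d) (beta : R) : R :=
  D x (dataset X (beta_neighborhood D T X x beta)).

Definition uniform_weight (R : realType) (b beta : R) : R :=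
  if 0 < beta <= b then b^-1 else 0.

(* beta = 0, where the local depth is not meaningful, has weight 0. *)
Definition integrated_local_depth (R : realType) (d n : nat)
    (D : 'rV[R]_d -> {mset 'rV[R]_d}%mset -> R)
    (T : ('I_n -> 'rV[R]_d) -> ('I_n -> R) -> nat -> {set 'I_n})
    (X : 'I_n -> 'rV[R]_d) (x : 'rV[R]_d) (b : R) : R :=
  \int[@lebesgue_measure R]_(beta in `[0, 1])
    (local_depth D T X x beta * uniform_weight b beta).

(* Main.v *)
(* Writing [g k] for the depth of [x] in the neighborhood of size [k], the
   integral is the mean [A m = (g 1 + ... + g m) / m], whose increments are
   [A m.+1 - A m = (\sum_(1 <= j <= m) (g m.+1 - g j)) / (m (m + 1))].
   Bounding each of the m summands by [Delta_dag] gives the second inequality;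
   bounding the j-th one by [(m + 1 - j) Delta] gives [m (m + 1) / 2 * Delta]
   in total, hence the first. *)
Require Import Defs.
From HB Require Import structures.
From mathcomp Require Import all_boot all_order all_algebra.
From mathcomp Require Import finmap multiset.
From mathcomp Require Import all_classical all_reals all_analysis.
From mathcomp Require Import measurable_realfun zify ring lra.

Set Implicit Arguments.
Unset Strict Implicit.
Unset Printing Implicit Defensive.

Import Order.TTheory GRing.Theory Num.Theory.
Import numFieldNormedType.Exports.

Local Open Scope classical_set_scope.
Local Open Scope ring_scope.

Lemma ceil_muln_eq (R : realType) (n j : nat) (t : R) : (0 < n)%N ->
  (Num.ceil (n%:R * t) == j.+1) =
    (t \in `]j%:R / n%:R, j.+1%:R / n%:R]).
Proof.
move=> n0; rewrite ceil_eq in_itv /= ltr_pdivrMr ?ltr0n// ler_pdivlMr ?ltr0n//.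
by rewrite (_ : j.+1%:Z - 1 = j)// ?(mulrC t)//; lia.
Qed.

Lemma absz_ceil_divnK (R : realType) (n i : nat) : (0 < n)%N ->
  `|Num.ceil (n%:R * (i%:R / n%:R) : R)|%N = i.
Proof.
move=> n0; rewrite mulrC divfK ?pnatr_eq0 -?lt0n//.
by rewrite -[i%:R]/(i%:Z%:~R) intrKceil.
Qed.

(** The ceiling is constant on each cell []j/n, (j+1)/n]], and these cells are disjoint, so at most
    one term of the sum survives at a given [t]. The factor [n/i] is the height of the weight. *)
Lemma ceil_step_indic (R : realType) (n i : nat) (g : nat -> R) (t : R) :
  (0 < n)%N ->
  g `|Num.ceil (n%:R * t)|%N * uniform_weight (i%:R / n%:R) t =
  \sum_(j < i) n%:R / i%:R * g j.+1 *
    \1_(`]j%:R / n%:R, j.+1%:R / n%:R]%classic : set R) t.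
Proof.
move=> n0; have n0R : 0 < n%:R :> R by rewrite ltr0n.
have indE (j : nat) :
    \1_(`]j%:R / n%:R, j.+1%:R / n%:R]%classic : set R) t =
    (Num.ceil (n%:R * t) == j.+1)%:R :> R.
  by rewrite indicE ceil_muln_eq// mem_setE.
(* The cutoff [i/n] is a cell boundary, so the support of the weight is a union of whole cells. *)
have wE : (0 < t <= i%:R / n%:R) = (0 < Num.ceil (n%:R * t) <= i).
  rewrite ceil_gt0 pmulr_rgt0// ler_pdivlMr// ceil_le_int.
  by rewrite -[i%:~R]/(i%:R) (mulrC t).
rewrite /uniform_weight wE; case: ifPn => [/andP[c0 ci]|nc]; last first.
  rewrite mulr0 big1// => j _; rewrite indE.
  case: eqP => [cE|_]; last by rewrite mulr0.
  by move: nc; rewrite cE; have := ltn_ord j; lia.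
have kP : (`|Num.ceil (n%:R * t)|.-1 < i)%N by lia.
rewrite (bigD1 (Ordinal kP))//= big1 ?addr0 => [|j jk].
  rewrite indE (_ : _ == _ = true); last by apply/eqP; lia.
  rewrite (_ : _.-1.+1 = `|Num.ceil (n%:R * t)|%N); last by lia.
  by rewrite invf_div mulr1 mulrC.
rewrite indE; case: eqP => [cE|_]; last by rewrite mulr0.
by case/negP: jk; apply/eqP/val_inj => /=; lia.
Qed.

(** A cell has length [1/n] and so contributes [(n/i) * g (j+1) * (1/n)]. Nonnegativity of [g]
    allows the exchange of sum and integral with measurability alone. *)
Lemma Rintegral_ceil_step (R : realType) (n i : nat) (g : nat -> R) :
  (forall k, 0 <= g k) -> (i <= n)%N -> (0 < n)%N ->
  \int[@lebesgue_measure R]_(t in `[0, 1])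
    (g `|Num.ceil (n%:R * t)|%N * uniform_weight (i%:R / n%:R) t) =
  (\sum_(1 <= j < i.+1) g j) / i%:R.
Proof.
move=> g0 iled n0; have n0R : 0 < n%:R :> R by rewrite ltr0n.
have step_int (j : 'I_i) :
    (\int[@lebesgue_measure R]_(t in `[0%R, 1%R]) (n%:R / i%:R * g j.+1 *
      \1_(`]j%:R / n%:R, j.+1%:R / n%:R]%classic : set R) t)%:E)%E =
    (g j.+1 / i%:R)%:E.
  under eq_integral do rewrite EFinM.
  rewrite ge0_integralZl_EFin//=; last 2 first.
  - exact/measurable_EFinP.
  - by rewrite !mulr_ge0 ?invr_ge0.
  (* Since [j < i <= n], the cell lies inside [[0, 1]] and keeps its full length. *)
  rewrite integral_indic//= setIidl; last first.
    move=> t /=; rewrite !in_itv/= => /andP[jt tj].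
    rewrite (le_trans _ (ltW jt)) ?mulr_ge0 ?invr_ge0//=.
    rewrite (le_trans tj)// ler_pdivrMr// mul1r ler_nat.
    exact: leq_trans (ltn_ord j) _.
  rewrite lebesgue_measure_itv/= lte_fin ltr_pM2r ?invr_gt0// ltr_nat ltnSn.
  rewrite -EFinB -EFinM -mulrBl -natrB// subSnn; congr EFin.
  have i0R : i%:R != 0 :> R by rewrite pnatr_eq0; have := ltn_ord j; lia.
  by field; rewrite i0R gt_eqF.
rewrite /Rintegral.
under eq_integral do rewrite ceil_step_indic// -sumEFin.
rewrite ge0_integral_sum//=; last 2 first.
- by move=> j; apply/measurable_EFinP; apply: measurable_funM.
- by move=> j t _; rewrite lee_fin mulr_ge0// !mulr_ge0 ?invr_ge0.
under eq_bigr do rewrite step_int.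
by rewrite sumEFin/= -mulr_suml big_add1 big_mkord.
Qed.

Lemma mean_increment (R : realFieldType) (g : nat -> R) (m : nat) :
  (0 < m)%N ->
  (\sum_(1 <= j < m.+2) g j) / m.+1%:R - (\sum_(1 <= j < m.+1) g j) / m%:R =
  (\sum_(1 <= j < m.+1) (g m.+1 - g j)) / (m.+1%:R * m%:R).
Proof.
move=> m0; rewrite sumrB big_const_nat iter_addr_0 subn1/= big_nat_recr//=.
rewrite -(mulr_natr (g _)) -(natr1 m).
have mN0 : m%:R != 0 :> R by rewrite pnatr_eq0 -lt0n.
have m1N0 : m%:R + 1 != 0 :> R by rewrite natr1 pnatr_eq0.
by field; rewrite mN0 m1N0.
Qed.

(** Induction on [m]: moving the reference value from [g m.+1] to [g m.+2] shifts the [m] old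
    differences by one step and adds a new difference equal to that step. This makes [m + 1] copies
    of it, exactly the growth of the triangular number [m (m + 1) / 2]. *)
Lemma sum_dist_last_le (R : realFieldType) (g : nat -> R) (C : R) (m : nat) :
  (forall k, (1 <= k <= m)%N -> `|g k.+1 - g k| <= C) ->
  `|\sum_(1 <= j < m.+1) (g m.+1 - g j)| <= m.+1%:R * m%:R / 2 * C.
Proof.
elim: m => [|m IH] gC; first by rewrite big_geq// normr0 mulr0 !mul0r.
have -> : \sum_(1 <= j < m.+2) (g m.+2 - g j) =
    \sum_(1 <= j < m.+1) (g m.+1 - g j) + m.+1%:R * (g m.+2 - g m.+1).
  rewrite !sumrB !big_const_nat !iter_addr_0 !subn1/= [X in _ - X]big_nat_recr//=.
  by rewrite -!(mulr_natr (g _)) -(natr1 m); ring.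
apply: le_trans (ler_normD _ _) _.
have /= Cm := gC m.+1 (leqnn _).
have {}IH := IH (fun k km => gC k ltac:(lia)).
rewrite normrM normr_nat.
have := ler_wpM2l (ler0n R m.+1) Cm.
by move: IH; rewrite -(natr1 m.+1) -(natr1 m); lra.
Qed.

Theorem proposition2p1 (R : realType) (d n b : nat)
    (D : 'rV[R]_d -> {mset 'rV[R]_d}%mset -> R)
    (T : ('I_n -> 'rV[R]_d) -> ('I_n -> R) -> nat -> {set 'I_n})
    (X : 'I_n -> 'rV[R]_d) (x : 'rV[R]_d)
    (hD : is_sample_depth D) (hT : is_top_rule T)
    (hb : (2 <= b <= n)%N) :
  let beta (i : nat) : R := i%:R / n%:R in
  let LD (i : nat) : R := local_depth D T X x (beta i) in
  let ILD (i : nat) : R := integrated_local_depth D T X x (beta i) in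
  let Delta : R :=
    \big[Num.max/0]_(2 <= i < b.+1) `|LD i - LD i.-1| in
  let Delta_dag : R :=
    \big[Num.max/0]_(1 <= i < b.+1) \big[Num.max/0]_(i.+1 <= j < b.+1)
      `|LD i - LD j| in
  \big[Num.max/0]_(2 <= i < b.+1) `|ILD i - ILD i.-1| <= 2^-1 * Delta /\
  (forall i : nat, (1 < i <= b)%N ->
     `|ILD i - ILD i.-1| <= Delta_dag / i%:R).
Proof.
move=> beta LD ILD Delta Delta_dag.
have n0 : (0 < n)%N by lia.
(* The local depth depends on the locality level only through the neighborhood size [k]. *)
pose g k := D x (dataset X
  (T X (fun i => D (X i) (reflected_dataset X x)) k)).
have LDE i : LD i = g i.
  by rewrite /LD /local_depth /beta_neighborhood absz_ceil_divnK.
have ILDE i : (i <= b)%N -> ILD i = (\sum_(1 <= j < i.+1) g j) / i%:R.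
  move=> ib; apply: (@Rintegral_ceil_step _ n i g) => //; last by lia.
  by move=> k; have /andP[] := hD x (dataset X
    (T X (fun i => D (X i) (reflected_dataset X x)) k)).
have incr i : (1 < i <= b)%N ->
    `|ILD i - ILD i.-1| =
    `|\sum_(1 <= j < i) (g i - g j)| / (i%:R * i.-1%:R).
  case: i => [//|m] /= mb; rewrite !ILDE ?mean_increment//; try lia.
  by rewrite normrM (ger0_norm (x := _^-1))// invr_ge0 mulr_ge0.
split.
  (* The default value 0 of the maximum must also lie below the bound. *)
  have Delta0 : 0 <= Delta by apply: bigmax_ge_id.
  rewrite big_seq_cond; apply: bigmax_le => [|i]; first by rewrite mulr_ge0.
  rewrite andbT mem_index_iota => ib; rewrite incr; last by lia.
  case: i ib => [//|m] /= mb.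
  rewrite ler_pdivrMr ?mulr_gt0 ?ltr0n//; last by lia.
  rewrite (_ : 2^-1 * _ * _ = m.+1%:R * m%:R / 2 * Delta); last by ring.
  apply: sum_dist_last_le => k km; rewrite -!LDE.
  apply: (le_bigmax_seq _ k.+1 _ (fun i => `|LD i - LD i.-1|)) => //.
  by rewrite mem_index_iota; lia.
case=> [//|m] mb; rewrite incr//= ler_pdivrMr ?mulr_gt0 ?ltr0n//; last by lia.
(* After clearing denominators the bound is [m] copies of [Delta_dag], one for each summand. *)
rewrite (_ : _ / _ * _ = \sum_(1 <= j < m.+1) Delta_dag); last first.
  rewrite big_const_nat iter_addr_0 subn1/= mulrA divfK ?pnatr_eq0//.
  by rewrite mulr_natr.
apply: le_trans (ler_norm_sum _ _ _) _.
(* [Delta_dag] ranges over pairs with the smaller index first, hence the swap. *)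
apply: ler_sum_nat => j jm; rewrite -!LDE distrC.
apply: (bigmax_sup_seq _ j) => //; first by rewrite mem_index_iota; lia.
apply: (le_bigmax_seq _ m.+1 _ (fun k => `|LD j - LD k|)) => //.
by rewrite mem_index_iota; lia.
Qed.
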